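(* For the preemptive mUETS problem, every online algorithm has competitive ratio $\Omega(\log m/\log\log m)$ and $\Omega(\log n/\log\log n)$, even when restricted to instances with unweighted type-specific setup times.
   Context: Preemptive mUETS: a finite set $J$ of $n$ jobs and $m$ identical machines, $n\ge m\ge 2$, all jobs available at time $0$. A known setup-time function $c:2^J\to\mathbb{R}_{\ge0}$ is monotone ($c(X)\le c(Y)$ for $X\subseteq Y$) and subadditive ($c(X)+c(Y)\ge c(X\cup Y)$ for disjoint $X,Y$). Each job $j$ has execution time $p_j\ge0$, unknown to an online algorithm until $j$ completes; $p(X)=\sum_{j\in X}p_j$. An algorithm forms batches (sets of jobs not completed and not assigned elsewhere) and may assign a batch $X$ to $k\ge1$ idle machines; each of these machines incurs setup time $c(X)$ and the jobs of $X$ are executed first-come first-served among them, so if uninterrupted the batch is completed between $c(X)+p(X)/k$ and $c(X)+p(X)/k+\max_{j\in X}p_j$ time units after it starts. Processing may be preempted: if a batch $X$ on $k$ machines is preempted $t$ time units after its start, the machines become available after at most $c(X)+\max_{j\in X}p_j$ further time units, the set $X'\subseteq X$ of completed jobs satisfies $c(X)+p(X')/k+\max_{j\in X}p_j\ge t$, completed jobs need not be reprocessed, and uncompleted jobs may be regrouped into new batches (incurring setup again). The makespan is the completion time of all jobs. The optimal makespan is $\min_{(X_1,\dots,X_m)\text{ partition of }J}\max_i(c(X_i)+p(X_i))$. The competitive ratio of an online algorithm is the supremum over instances of its makespan divided by the optimal makespan. Unweighted type-specific setup times: $J$ is partitioned into classes $(J_t)_{t\in T}$ (types), and $c(X)=|\{t\in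 T: X\cap J_t\neq\emptyset\}|$ for $X\subseteq J$. *)

(* Defs.v *)
From HB Require Import structures.
From mathcomp Require Import all_boot all_order all_algebra.
From mathcomp Require Import all_classical all_reals all_analysis.

Set Implicit Arguments.
Unset Strict Implicit.
Unset Printing Implicit Defensive.

Import Order.TTheory GRing.Theory Num.Theory.

Local Open Scope classical_set_scope.
Local Open Scope ring_scope.

(* The part of an instance that is known to the online algorithm. *)
Record problem (R : realType) := Problem {
  njobs : nat;
  nmach : nat;
  setup : {set 'I_njobs} -> R }.
Arguments setup {R} p X.

Definition mUETS (R : realType) : set (problem R) := [set P |
  [/\ (2 <= nmach P <= njobs P)%N,
      forall X, 0 <= setup P X,
      forall X Y : {set 'I_(njobs P)}, X \subset Y -> setup P X <= setup P Y &
      forall X Y : {set 'I_(njobs P)}, (X :&: Y)%SET = finset.set0 ->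
        setup P (X :|: Y)%SET <= setup P X + setup P Y] ].

(* The blocks of the partition [cls] are the classes J_t. *)
Definition unweighted_types (R : realType) : set (problem R) := [set P |
  mUETS P /\
  exists2 cls : {set {set 'I_(njobs P)}},
    finset.partition cls [set: 'I_(njobs P)]%SET &
    forall X, setup P X = #|[set B in cls | X :&: B != finset.set0]%SET|%:R ].

Definition ptimes (R : realType) (P : problem R) := 'I_(njobs P) -> R.

Definition nonneg (R : realType) (P : problem R) : set (ptimes P) :=
  [set p | forall j, 0 <= p j].

(* A partition (X_1, ..., X_m) of the jobs, with possibly empty parts, is
   encoded by the map f sending each job to the index of its part. *)
Definition part_load (R : realType) (P : problem R) (p : ptimes P)
    (f : {ffun 'I_(njobs P) -> 'I_(nmach P)}) (i : 'I_(nmach P)) : R :=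
  setup P [set j | f j == i]%SET + \sum_(j | f j == i) p j.

Definition opt (R : realType) (P : problem R) (p : ptimes P) : \bar R :=
  \big[Order.min/+oo%E]_(f : {ffun 'I_(njobs P) -> 'I_(nmach P)})
    (\big[Order.max/0]_(i < nmach P) part_load p f i)%:E.

(* One assignment of a batch to machines, with what happened to it.  All times
   are absolute.  [queue] lists the batch in its first-come first-served order;
   [preempt] is the time of the preemption, if any; [release i] is the time at
   which machine [i] of the team becomes available again; [exec j = Some (i, s)]
   when machine [i] begins to execute job [j] at time [s]. *)
Record run (R : realType) (P : problem R) := Run {
  queue : seq 'I_(njobs P);
  team : {set 'I_(nmach P)};
  start : R;
  preempt : option R;
  release : 'I_(nmach P) -> R;
  exec : 'I_(njobs P) -> option ('I_(nmach P) * R) }.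

Definition schedule (R : realType) (P : problem R) := set (run P).

Section Runs.
Variables (R : realType) (P : problem R) (p : ptimes P).
Implicit Types (r : run P) (S : schedule P) (i : 'I_(nmach P))
  (j : 'I_(njobs P)) (t : R).

Definition batch r : {set 'I_(njobs P)} := [set j in queue r]%SET.

Definition ready r : R := start r + setup P (batch r).

Definition pmax r : R := \big[Order.max/0]_(j in batch r) p j.

Definition started r j t : Prop :=
  exists i s, exec r j = Some (i, s) /\ s <= t.

(* A job whose machine is released before the job is done has been aborted, and
   the time spent on it is lost. *)
Definition completed r j t : Prop :=
  exists i s, exec r j = Some (i, s) /\ s + p j <= Order.min t (release r i).

Definition finished r : {set 'I_(njobs P)} :=
  [set j | if exec r j is Some (i, s) then s + p j <= release r i else false]%SET.

Definition preempted r t : Prop := exists2 tp, preempt r = Some tp & tp <= t.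

Definition busy r i t : Prop :=
  exists j s, exec r j = Some (i, s) /\ s <= t < s + p j.

Definition exhausted r i t : Prop :=
  [/\ ready r <= t,
      forall j, j \in queue r -> started r j t &
      forall j s, exec r j = Some (i, s) -> s + p j <= t].

Definition batch_done r t : Prop :=
  ready r <= t /\ forall j, j \in queue r -> completed r j t.

Definition fcfs r : Prop :=
  [/\ forall i j s, exec r j = Some (i, s) ->
        [/\ j \in queue r, i \in team r & ready r <= s <= release r i],
      forall i j j' s s', j != j' ->
        exec r j = Some (i, s) -> exec r j' = Some (i, s') ->
        s + p j <= s' \/ s' + p j' <= s,
      forall i j j' s', j \in queue r ->
        (index j (queue r) < index j' (queue r))%N ->
        exec r j' = Some (i, s') -> started r j s' &
      forall i j t, i \in team r -> j \in queue r ->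
        ready r <= t < release r i -> ~ preempted r t -> ~ started r j t ->
        busy r i t].

(* A machine leaves the batch because of a preemption, or when nothing is left
   for it to do; in the latter case it may or may not have to wait for the rest
   of the team.  Whether a preempted machine aborts or completes its current
   operation is left open. *)
Definition valid_release r i : Prop :=
  (exists2 tp, preempt r = Some tp &
     tp <= release r i <= tp + setup P (batch r) + pmax r) \/
  (exhausted r i (release r i) /\
     forall t, batch_done r t -> release r i <= t).

Definition valid_preemption r : Prop :=
  forall tp, preempt r = Some tp ->
    start r <= tp /\
    tp - start r <= setup P (batch r)
                    + (\sum_(j in finished r) p j) / #|team r|%:R + pmax r.

Definition valid_run r : Prop :=
  [/\ [/\ uniq (queue r), queue r != [::] & team r != finset.set0],
      0 <= start r,
      fcfs r,
      forall i, i \in team r -> valid_release r i &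
      valid_preemption r].

(* Job [j] of [r] may belong to another batch formed at time [t]. *)
Definition freed r j t : Prop :=
  [/\ preempted r t, j \notin finished r &
      forall i s, exec r j = Some (i, s) -> release r i <= t].

Definition valid_schedule S : Prop :=
  [/\ forall r, S r -> valid_run r,
      forall r r' i, S r -> S r' -> r <> r' -> i \in team r -> i \in team r' ->
        release r i <= start r' \/ release r' i <= start r &
      forall r r' j, S r -> S r' -> r <> r' ->
        j \in queue r -> j \in queue r' ->
        freed r j (start r') \/ freed r' j (start r)].

Definition makespan S : \bar R :=
  ereal_inf [set T%:E | T in
    [set T : R | forall j, exists2 r, S r & completed r j T]].

(* [p'] cannot be told apart from [p] by someone who has observed the execution
   [S] under [p] up to and including time [t]: the execution time of a job is
   revealed when it completes, and an attempt at a job that has not completed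
   only reveals that the job is longer than the time spent on it. *)
Definition indistinguishable S t (p' : ptimes P) : Prop :=
  forall r i j s, S r -> exec r j = Some (i, s) -> s <= t ->
    let elapsed := Order.min t (release r i) - s in
    if p j <= elapsed then p' j = p j else elapsed < p' j.

End Runs.

Section Algorithms.
Variable R : realType.

Definition same_run_upto (P : problem R) (t : R) (r r' : run P) : Prop :=
  [/\ [/\ queue r = queue r', team r = team r' & start r = start r'],
      forall u, u <= t -> (preempt r = Some u <-> preempt r' = Some u),
      forall i u, i \in team r -> u <= t ->
        (release r i = u <-> release r' i = u) &
      forall i j u, u <= t ->
        (exec r j = Some (i, u) <-> exec r' j = Some (i, u))].

Definition same_upto (P : problem R) (t : R) (S S' : schedule P) : Prop :=
  (forall r, S r -> start r <= t -> exists2 r', S' r' & same_run_upto t r r') /\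
  (forall r', S' r' -> start r' <= t -> exists2 r, S r & same_run_upto t r r').

(* A deterministic algorithm, seen through the schedules that it produces. *)
Definition algorithm := forall P : problem R, ptimes P -> schedule P.

(* On the problems of [D], the algorithm obeys the rules of the model and what it
   does up to time [t] depends only on what has been revealed by time [t]. *)
Definition online_algorithm (D : set (problem R)) (A : algorithm) : Prop :=
  forall P, D P -> forall p : ptimes P, nonneg p ->
    valid_schedule p (A P p) /\
    forall (t : R) (p' : ptimes P), nonneg p' ->
      indistinguishable p (A P p) t p' -> same_upto t (A P p) (A P p').

(* [opt p] is at least 1 on [unweighted_types], so the quotient is a genuine one
   there; the makespan of a schedule that never completes all jobs is +oo. *)
Definition competitive_ratio (A : algorithm) (D : set (problem R)) : \bar R :=
  ereal_sup [set x : \bar R | exists P, D P /\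
    exists p : ptimes P, nonneg p /\ x = (makespan p (A P p) / opt p)%E].

End Algorithms.

(* Main.v *)
(* Let q = L^2 and take q^L types, indexed by words of length L over q letters,
   with more than m jobs of each type.  Every execution time is 0 or 1.  At each
   integer time l < L the adversary fixes one more letter of a secret word; from
   then on the jobs that have not been started last 1 if their type agrees with
   the letters fixed so far, and 0 otherwise.  A setup takes at least 1, so a
   machine that begins a job in ]l, l + 1] was already held by its batch at time
   l; as that setup takes at most L, the batch shows at most L of the q possible
   l-th letters.  On average over the letters, at most m / L machines hold
   a given one, and the adversary fixes a letter that attains this.  A machine
   begins at most one unit job in ]l, l + 1], so at most m unit jobs are begun by
   time L, and all the others are then declared to last 0.  Hence the optimum is
   at most 3, whereas by time L the algorithm has not even begun all the jobs of
   the secret type, each of which lasts 1 if begun.  The number of types is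
   L^(2L), which makes L of the order of log m / log log m. *)
Require Import Defs.
From mathcomp Require Import all_boot all_order all_algebra.
From mathcomp Require Import all_classical all_reals all_analysis.
From mathcomp Require Import lra zify.

Set Implicit Arguments.
Unset Strict Implicit.
Unset Printing Implicit Defensive.

Import Order.TTheory GRing.Theory Num.Theory.

Local Open Scope classical_set_scope.
Local Open Scope ring_scope.

(** * Finite counting *)

Lemma leq_card_rel (T T' : finType) (Q : T -> T' -> Prop) (A : {set T}) (B : {set T'}) :
  (forall x, x \in A -> exists2 y, y \in B & Q x y) ->
  (forall x x' y, x \in A -> x' \in A -> Q x y -> Q x' y -> x = x') ->
  (#|A| <= #|B|)%N.
Proof.
move=> ex uniq; pose g y := [pick x in A | `[< Q x y >]].
rewrite -(card_imset A (@Some_inj _)).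
apply: leq_trans (leq_imset_card g B); apply/subset_leq_card/fintype.subsetP => o.
case/imsetP=> x xA ->; have [y yB Qxy] := ex x xA.
apply/imsetP; exists y => //; rewrite /g; case: pickP => [x' /andP[x'A /asboolP Qx'y]|/(_ x)].
  by congr Some; exact: uniq Qxy Qx'y.
by rewrite xA /=; move/asboolP: Qxy => ->.
Qed.

(* Double counting of the pairs [(i, d)] with [d \in F i]. *)
Lemma sparse_value (I J : finType) (F : I -> {set J}) (L : nat) :
  #|J| = (L * L)%N -> (0 < L)%N -> (forall i, (#|F i| <= L)%N) ->
  exists d, (#|[set i | d \in F i]%SET| * L <= #|I|)%N.
Proof.
move=> cJ L0 cF; apply/existsP; apply: contraT; rewrite negb_exists => /forallP h.
have e : (\sum_d #|[set i | d \in F i]%SET| = \sum_i #|F i|)%N.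
  transitivity (\sum_d \sum_i (d \in F i : nat))%N.
    by apply: eq_bigr => d _; rewrite -sum1dep_card big_mkcond.
  by rewrite exchange_big; apply: eq_bigr => i _; rewrite -sum1_card [RHS]big_mkcond.
have h1 : (#|J| * #|I|.+1 <= (\sum_d #|[set i | d \in F i]%SET|) * L)%N.
  rewrite big_distrl /= -sum_nat_const; apply: leq_sum => d _.
  by have := h d; rewrite -ltnNge.
have h2 : (\sum_i #|F i| <= #|I| * L)%N.
  by rewrite -sum_nat_const; apply: leq_sum.
move: h1; rewrite e cJ => h1; have := leq_trans h1 (leq_mul h2 (leqnn L)); nia.
Qed.

(** * Begun jobs, and machines held across a unit time interval *)

Section Adversary.
Variables (R : realType) (P : problem R) (T : finType) (ty : 'I_(njobs P) -> T).
Hypothesis setupE : forall X, setup P X = #|(ty @: X)%SET|%:R.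
Implicit Types (S : schedule P) (Z : {set 'I_(njobs P)}) (t : R).

Definition unit_times Z : ptimes P := fun j => (j \in Z)%:R.

Lemma unit_times_nonneg Z : nonneg (unit_times Z).
Proof. by move=> j; rewrite /unit_times ler0n. Qed.

Definition started_by S t : {set 'I_(njobs P)} :=
  [set j | `[< exists2 r, S r & started r j t >]]%SET.

Lemma started_byP S t j : reflect (exists2 r, S r & started r j t) (j \in started_by S t).
Proof. by rewrite inE; exact: asboolP. Qed.

Lemma exec_bounds (p : ptimes P) (r : run P) j i s : valid_run p r -> exec r j = Some (i, s) ->
  [/\ j \in batch r, i \in team r, start r + setup P (batch r) <= s, s <= release r i & 0 <= start r].
Proof.
case=> _ s0 [ex _ _ _] _ _ /ex[jq it /andP[? ?]]; split => //; by rewrite inE.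
Qed.

Lemma setup_ge1 (X : {set 'I_(njobs P)}) j : j \in X -> 1 <= setup P X.
Proof. by move=> jX; rewrite setupE ler1n card_gt0; apply/set0Pn; exists (ty j); apply: imset_f. Qed.

Lemma started_by_same t S S' (p p' : ptimes P) : valid_schedule p S -> valid_schedule p' S' ->
  same_upto t S S' -> started_by S t = started_by S' t.
Proof.
have sub p1 p2 S1 S2 : valid_schedule p1 S1 -> valid_schedule p2 S2 ->
    (forall r, S1 r -> start r <= t -> exists2 r', S2 r' & 
       forall i j u, u <= t -> exec r j = Some (i, u) -> exec r' j = Some (i, u)) ->
    started_by S1 t \subset started_by S2 t.
  move=> [v1 _ _] _ h; apply/fintype.subsetP => j; case/started_byP=> r Sr [i [s [e st]]].
  have [jb _ le _ _] := exec_bounds (v1 _ Sr) e.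
  have ge1 := setup_ge1 jb.
  have [|r' S2r' sr] := h _ Sr; first by lra.
  by apply/started_byP; exists r' => //; exists i, s; split => //; exact: sr.
move=> v v' [h1 h2]; apply/eqP; rewrite finset.eqEsubset; apply/andP; split.
  apply: sub v v' _ => r Sr rt; have [r' S'r' [_ _ _ e]] := h1 _ Sr rt.
  by exists r' => // i j u ut; case: (e i j u ut).
apply: sub v' v _ => r' Sr rt; have [r S'r' [_ _ _ e]] := h2 _ Sr rt.
by exists r => // i j u ut; case: (e i j u ut).
Qed.

(* A machine may begin a job in ]t, t + 1] only if it is held at time [t] by a
   batch whose setup can be over by [t + 1]. *)
Definition holds S t i (r : run P) : Prop :=
  [/\ S r, i \in team r, start r <= t < release r i & setup P (batch r) <= t + 1].

Lemma holds_uniq (p : ptimes P) S t i r r' : valid_schedule p S -> holds S t i r -> holds S t i r' -> r = r'.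
Proof.
move=> [_ ex _] [Sr ir /andP[a b] _] [Sr' ir' /andP[a' b'] _].
have [//|ne] := pselect (r = r').
by have [|] := ex r r' i Sr Sr' ne ir ir' => ?; exfalso; lra.
Qed.

(** The setup takes at least 1, so a batch with a job begun by [t + 1] was started by [t]; no run
    starts before 0, so its setup takes at most [t + 1]. *)
Lemma exec_holds (p : ptimes P) S t r i j s : valid_schedule p S -> S r -> exec r j = Some (i, s) ->
  t < s <= t + 1 -> holds S t i r.
Proof.
move=> [v _ _] Sr e /andP[ts st]; have [jb it le sr s0] := exec_bounds (v _ Sr) e.
have := setup_ge1 jb; split => //; last lra.
by apply/andP; split; lra.
Qed.

Lemma holds_same S S' t i r' : same_upto t S S' -> holds S' t i r' ->
  exists2 r, holds S t i r & batch r = batch r'.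
Proof.
move=> [_ h2] [Sr' ir' /andP[a b] st]; have [r Sr [[q tm sr] _ rel _]] := h2 _ Sr' a.
have bb : batch r = batch r' by rewrite /batch q.
(* If [r] released [i] by time [t], then [same_run_upto] would force the same release on [r'], which
   still holds [i] after [t]. *)
exists r => //; split; rewrite ?bb ?tm ?sr ?a //= ltNge; apply/negP => le.
have := rel i (release r i); rewrite tm => /(_ ir' le)[/(_ erefl) e _].
by move: b; rewrite e; lra.
Qed.

(** Both jobs belong to the one run holding [i], where executions on a machine do not overlap:
    distinct unit jobs begin at least 1 apart, too far for a half-open interval of length 1. *)
Lemma unit_jobs_per_machine Z S t r r' i j j' s s' : valid_schedule (unit_times Z) S ->
  S r -> S r' -> exec r j = Some (i, s) -> exec r' j' = Some (i, s') ->
  t < s <= t + 1 -> t < s' <= t + 1 -> j \in Z -> j' \in Z -> j = j'.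
Proof.
move=> v Sr Sr' e e' hs hs' jZ j'Z.
have rr : r = r'.
  exact: holds_uniq v (exec_holds v Sr e hs) (exec_holds v Sr' e' hs').
subst r'; apply/eqP; apply: contraT => ne.
case: (v) => /(_ _ Sr)[_ _ [_ disj _ _] _ _] _ _.
have := disj i j j' s s' ne e e'; rewrite /unit_times jZ j'Z /= => {e e' disj}.
by move: hs hs' => /andP[? ?] /andP[? ?] [?|?]; lra.
Qed.

(** With [c] reading one letter of a type, these are the letters shown by the batch that holds
    machine [i]. *)
Definition served (J : finType) (c : T -> J) S t i : {set J} :=
  [set d | `[< exists2 r, holds S t i r & exists2 j, j \in batch r & c (ty j) = d >]]%SET.

Lemma servedP (J : finType) (c : T -> J) S t i d :
  reflect (exists2 r, holds S t i r & exists2 j, j \in batch r & c (ty j) = d)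
    (d \in served c S t i).
Proof. by rewrite inE; exact: asboolP. Qed.

Lemma card_served (J : finType) (c : T -> J) p S t i L : valid_schedule p S -> t + 1 <= L%:R ->
  (#|served c S t i| <= L)%N.
Proof.
move=> v tL; have [->|/set0Pn[d]] := eqVneq (served c S t i) finset.set0; first by rewrite cards0.
case/servedP=> r hr _.
have : (#|(ty @: batch r)%SET| <= L)%N.
  by case: hr => _ _ _; rewrite setupE => le; rewrite -(ler_nat R); lra.
apply: leq_trans; apply: leq_trans (leq_imset_card c _).
apply/subset_leq_card/fintype.subsetP => e.
case/servedP=> r' hr' [j jr' <-]; rewrite (holds_uniq v hr hr').
by do 2 apply: imset_f.
Qed.

(** Each new unit job is mapped to the machine that begins it, injectively by
    [unit_jobs_per_machine]. The bound refers to [S], not [S'], because [d] is chosen before the new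
    times [Z] are fixed; agreement up to [t] transfers it. *)
Lemma card_new_units (J : finType) (c : T -> J) d p S Z S' t : valid_schedule p S ->
  valid_schedule (unit_times Z) S' -> same_upto t S S' ->
  (forall j, j \in Z -> j \notin started_by S' t -> c (ty j) = d) ->
  (#|(Z :&: started_by S' (t + 1)) :\: started_by S' t|%SET <= #|[set i | d \in served c S t i]%SET|)%N.
Proof.
move=> v v' sm cd.
pose Q j i := exists r s, [/\ S' r, exec r j = Some (i, s) & t < s <= t + 1].
apply: (@leq_card_rel _ _ Q) => [j|j j' i]; last first.
  rewrite !inE => /andP[_ /andP[jZ _]] /andP[_ /andP[jZ' _]] [r [s [Sr e hs]]] [r' [s' [Sr' e' hs']]].
  exact: unit_jobs_per_machine v' Sr Sr' e e' hs hs' jZ jZ'.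
rewrite inE => /andP[nst /setIP[jZ]]; have cj := cd _ jZ nst.
case/started_byP=> r Sr [i [s [e st]]].
have ts : t < s.
  rewrite ltNge; apply: contra nst => st'; apply/started_byP; exists r => //.
  by exists i, s.
have hs : t < s <= t + 1 by rewrite ts.
have h := exec_holds v' Sr e hs.
have [r0 h0 bb] := holds_same sm h.
exists i; last by exists r, s.
rewrite inE; apply/servedP; exists r0 => //; exists j => //; rewrite bb.
by case: v' => /(_ _ Sr) vr _ _; have [] := exec_bounds vr e.
Qed.

End Adversary.

(** * The game against an online algorithm *)

Section LowerBound.
Variables (R : realType) (D : set (problem R)) (A : algorithm R) (P : problem R) (L : nat)
  (ty : 'I_(njobs P) -> {ffun 'I_L -> 'I_(L * L)}).
Hypotheses (onA : online_algorithm D A) (DP : D P).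
Hypothesis setupE : forall X, setup P X = #|(ty @: X)%SET|%:R.
Implicit Types (Z : {set 'I_(njobs P)}) (b : {ffun 'I_L -> 'I_(L * L)}).

Let sched Z := @A P (unit_times Z).
Let W Z (l : nat) := started_by (sched Z) l%:R.

Let validS Z : valid_schedule (unit_times Z) (sched Z).
Proof. by have [] := onA DP (unit_times_nonneg Z). Qed.

Lemma same_upto_unit_times Z Z' (t : R) :
  Z :&: started_by (sched Z) t = Z' :&: started_by (sched Z) t ->
  same_upto t (sched Z) (sched Z').
Proof.
move=> /setP eZ; have [_] := onA DP (unit_times_nonneg Z).
apply; first exact: unit_times_nonneg.
move=> r i j s Sr e st /=.
have jW : j \in started_by (sched Z) t by apply/started_byP; exists r => //; exists i, s.
have -> : unit_times Z' j = unit_times Z j.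
  by have := eZ j; rewrite /unit_times !finset.in_setI jW !andbT => ->.
by case: leP.
Qed.

Definition agree (l : nat) b j := [forall k : 'I_L, (k < l)%N ==> (ty j k == b k)].

(** Induction over integer times. [Z] is the current set of unit jobs, and only the first [l]
    letters of [b] are committed. The first clause keeps all jobs of the secret type at length 1;
    the last one, at [l = L], leaves at most [nmach P] begun unit jobs. *)
Lemma adversary (l : nat) : (0 < L)%N -> (l <= L)%N -> exists Z b,
  [/\ forall j, agree l b j -> j \in Z,
      forall j, j \in Z -> j \notin W Z l -> agree l b j &
      (#|Z :&: W Z l| * L <= l * nmach P)%N].
Proof.
move=> L0; elim: l => [_|l IH lL].
  exists [set: 'I_(njobs P)]%SET, [ffun=> Ordinal (leq_mul L0 L0)].
  split=> [j _|j _ _|]; rewrite ?inE //; first by apply/forallP.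
  (* Nothing is begun by time 0, since every setup takes at least 1. *)
  rewrite (_ : _ :&: _ = finset.set0) ?cards0 //; apply/setP => j; rewrite finset.in_set0 finset.setTI.
  apply/negP => /started_byP[r Sr [i [s [e s0]]]].
  have [v _ _] := validS [set: 'I_(njobs P)]%SET.
  have [jb _ le _ r0] := exec_bounds (v _ Sr) e.
  have := setup_ge1 setupE jb; lra.
have [Z [b [bZ Zb cZ]]] := IH (ltnW lL).
pose c (t : {ffun 'I_L -> 'I_(L * L)}) := t (Ordinal lL).
have tL : l%:R + 1 <= L%:R :> R by rewrite natr1 ler_nat.
have [|i|d] := @sparse_value _ _ (served ty c (sched Z) (l%:R : R)) L _ L0.
  by rewrite card_ord.
  exact: card_served (validS Z) tL.
rewrite card_ord => cd.
pose b' := [ffun k => if k == Ordinal lL then d else b k].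
have agS j : agree l.+1 b' j = agree l b j && (c (ty j) == d).
  apply/forallP/andP => [h|[/forallP h e] k].
    split; last by have := h (Ordinal lL); rewrite ffunE eqxx /= ltnSn.
    apply/forallP => k; apply/implyP => kl; have := h k.
    rewrite ffunE ltnS (ltnW kl) /= ifN //; apply: contraTneq kl => -> /=.
    by rewrite ltnn.
  rewrite ffunE ltnS; case: (eqVneq k (Ordinal lL)) => [->|ne]; first by rewrite leqnn.
  apply/implyP => kl; have := h k; rewrite ltn_neqAle kl andbT.
  by move/implyP; apply; apply: contra ne => /eqP kk; apply/eqP/val_inj.
(* Only times of jobs not begun by time [l] change, so the two schedules agree up to [l]. *)
pose Z' := [set j in Z | (j \in W Z l) || agree l.+1 b' j]%SET.
have ZZ' : Z :&: W Z l = Z' :&: W Z l.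
  apply/setP => j; rewrite !finset.in_setI [j \in Z']finset.in_set.
  by case: (j \in W Z l); rewrite ?andbF ?orTb ?andbT.
have sm := same_upto_unit_times ZZ'.
have WW : W Z l = W Z' l by exact: (started_by_same setupE (validS Z) (validS Z') sm).
exists Z', b'; split.
- by move=> j aj; rewrite inE aj orbT andbT bZ //; move: aj; rewrite agS => /andP[].
- move=> j; rewrite inE => /andP[_ /orP[jW|//]] /negP[].
  move: jW; rewrite WW => /started_byP[r Sr [i [s [e sl]]]].
  apply/started_byP; exists r => //; exists i, s; split => //.
  by rewrite (le_trans sl) // ler_nat.
have H := card_new_units (c := c) (d := d) setupE (validS Z) (validS Z') sm.
have {}H : (#|(Z' :&: W Z' l.+1) :\: W Z' l| * L <= nmach P)%N.
  apply: leq_trans cd; rewrite leq_mul2r; apply/orP; right.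
  rewrite /W -natr1; apply: H => j; rewrite inE WW => /andP[_ /orP[->//|]].
  by rewrite agS => /andP[_ /eqP].
rewrite -(cardsID (W Z' l)) mulnDl mulSn addnC leq_add //; apply: leq_trans cZ.
rewrite leq_mul2r; apply/orP; right; apply: subset_leq_card.
by rewrite ZZ' WW; apply: finset.setSI; apply: finset.subsetIl.
Qed.

(** The final set keeps only the unit jobs begun by time [L]. Completing everything before [L] would
    require beginning all jobs of the secret type by then, and these alone outnumber that set. *)
Lemma makespan_lower : (0 < L)%N ->
  (forall t, (nmach P < #|[set j | ty j == t]%SET|)%N) -> exists Z,
  (#|Z| <= nmach P)%N /\ (L%:R%:E <= makespan (unit_times Z) (sched Z))%E.
Proof.
move=> L0 fib; have [Z [b [bZ _ cZ]]] := adversary L0 (leqnn L).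
pose Z' := Z :&: W Z L.
have ZZ' : Z :&: W Z L = Z' :&: W Z L by rewrite /Z' -finset.setIA finset.setIid.
have sm := same_upto_unit_times ZZ'.
have WW : W Z L = W Z' L by exact: (started_by_same setupE (validS Z) (validS Z') sm).
have cZ' : (#|Z'| <= nmach P)%N by rewrite -(leq_pmul2r L0) [leqRHS]mulnC.
exists Z'; split => //; apply: le_ereal_inf_tmp => _ [t all_done <-].
rewrite lee_fin leNgt; apply/negP => tL.
suff : [set j | ty j == b]%SET \subset Z'.
  by move=> /subset_leq_card; rewrite leqNgt (leq_ltn_trans cZ' (fib b)).
apply/fintype.subsetP => j; rewrite finset.in_set => /eqP tyj; rewrite finset.in_setI bZ /=; last first.
  by apply/forallP => k; apply/implyP => _; rewrite tyj.
rewrite WW; have [r Sr [i [s [e le]]]] := all_done j.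
apply/started_byP; exists r => //; exists i, s; split => //.
have : 0 <= unit_times Z' j :> R by exact: unit_times_nonneg.
by move: le; rewrite le_min => /andP[? _] ?; lra.
Qed.

End LowerBound.

(** * Bounds on the optimum *)

Section Opt.
Variables (R : realType) (P : problem R) (T : finType) (ty : 'I_(njobs P) -> T).
Hypothesis setupE : forall X, setup P X = #|(ty @: X)%SET|%:R.
Implicit Types (Z : {set 'I_(njobs P)}).

Lemma opt_gt0 Z : (0 < njobs P)%N -> (0 < opt (unit_times (P := P) Z))%E.
Proof.
move=> n0; rewrite /opt; elim/big_ind: _ => //= [x y x0 y0|f _]; first by rewrite lt_min x0 y0.
pose j0 := Ordinal n0; rewrite lte_fin.
apply: (@lt_le_trans _ _ (part_load (unit_times Z) f (f j0))); last exact: le_bigmax.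
rewrite /part_load; apply: ltr_pwDl; last by apply: sumr_ge0 => j _; exact: unit_times_nonneg.
by rewrite (lt_le_trans ltr01) // (setup_ge1 setupE (j := j0)) // inE.
Qed.

(** A machine can take the zero-time jobs of one type and one job of [Z]: setup at most 2, execution
    at most 1. *)
Lemma opt_le3 Z : (#|T| <= nmach P)%N -> (#|Z| <= nmach P)%N -> (opt (unit_times (P := P) Z) <= 3%:E)%E.
Proof.
move=> cT cZ.
have mach_ty j : (enum_rank (ty j) < nmach P)%N by exact: leq_trans (ltn_ord _) cT.
have mach_Z j : j \in Z -> (index j (enum Z) < nmach P)%N.
  by move=> jZ; apply: leq_trans cZ; rewrite cardE index_mem mem_enum.
(* Outside [Z] the index is [#|Z|], which may still be a machine number, so both branches need the
   fallback to the machine of the type. *)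
pose f := [ffun j => if insub (index j (enum Z)) is Some i then
   if j \in Z then i else Ordinal (mach_ty j) else Ordinal (mach_ty j)].
have fZ j : j \in Z -> f j = index j (enum Z) :> nat.
  by move=> jZ; rewrite ffunE insubT ?mach_Z //= => ?; rewrite jZ.
have fNZ j : j \notin Z -> f j = Ordinal (mach_ty j).
  by move=> /negPf jZ; rewrite ffunE jZ; case: insub.
apply: (@bigmin_inf _ _ _ _ f) => //; rewrite lee_fin; apply: bigmax_le => // i _.
pose X := [set j | f j == i]%SET.
have XZ1 : (#|X :&: Z| <= 1)%N.
  apply/card_le1_eqP => x y; rewrite !finset.in_setI !finset.in_set.
  move=> /andP[/eqP fx xZ] /andP[/eqP fy yZ].
  by apply: (@index_inj _ x (enum Z)); rewrite ?mem_enum -?fZ ?fx ?fy.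
have XD1 : (#|(ty @: (X :\: Z))%SET| <= 1)%N.
  apply/card_le1_eqP => _ _ /imsetP[x + ->] /imsetP[y + ->].
  rewrite !finset.in_setD !finset.in_set => /andP[xZ /eqP fx] /andP[yZ /eqP fy].
  by apply/enum_rank_inj/val_inj; move: fx; rewrite -fy !fNZ // => -[].
rewrite /part_load setupE -/X.
have -> : \sum_(j | f j == i) unit_times (R := R) Z j = #|X :&: Z|%:R.
  rewrite /unit_times -natr_sum; congr _%:R; rewrite -sum1_card big_mkcond [RHS]big_mkcond /=.
  by apply: eq_bigr => j _; rewrite finset.in_setI finset.in_set; case: eqP; case: (j \in Z).
have cX : (#|(ty @: X)%SET| <= 2)%N.
  rewrite -(setID X Z) imsetU (leq_trans (leq_card_setU _ _)) // -[2%N]/(1 + 1)%N leq_add //.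
  by apply: leq_trans XZ1; exact: leq_imset_card.
by rewrite -natrD ler_nat (leq_add cX XZ1).
Qed.

End Opt.

(** * Construction of the instances *)

Lemma unweighted_types_of (R : realType) (n m : nat) (T : finType) (ty : 'I_n -> T) :
  (2 <= m <= n)%N ->
  unweighted_types (@Problem R n m (fun X => #|(ty @: X)%SET|%:R)).
Proof.
move=> mn; split; first split => //= [X Y XY|X Y _].
- by rewrite ler_nat subset_leq_card // imsetS.
- by rewrite -natrD ler_nat imsetU leq_card_setU.
exists (preim_partition ty [set: 'I_n]%SET) => [|X /=]; first exact: preim_partitionP.
congr _%:R; pose fib t := [set j | ty j == t]%SET.
(* Injectivity of [fib] is restricted to types that occur, as all others share the empty fibre. *)
have <- : #|(fib @: (ty @: X))%SET| = #|(ty @: X)%SET|.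
  apply: card_in_imset => _ t /imsetP[j jX ->] _ /setP/(_ j).
  by rewrite !finset.in_set eqxx => /esym/eqP.
apply: eq_card => B; rewrite finset.in_set; apply/imsetP/andP.
  case=> _ /imsetP[j jX ->] ->; split; last first.
    by apply/set0Pn; exists j; rewrite finset.in_setI jX finset.in_set /=.
  apply/imsetP; exists j; rewrite ?finset.in_setT //.
  by apply/setP => k; rewrite !finset.in_set /= eq_sym.
case=> /imsetP[k _ ->] /set0Pn[j]; rewrite !finset.in_setI !finset.in_set /= => /andP[jX /eqP tkj].
exists (ty k); last by apply/setP => l; rewrite !finset.in_set /= eq_sym.
by rewrite tkj; exact: imset_f.
Qed.

(** Types are dealt out cyclically: the jobs [i * #|T| + enum_rank t] have type [t]. *)
Lemma large_fibres (n k : nat) (T : finType) : (0 < #|T|)%N -> (#|T| * k <= n)%N ->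
  exists ty : 'I_n -> T, forall t, (k <= #|[set j | ty j == t]%SET|)%N.
Proof.
move=> T0 le; pose ty (j : 'I_n) := enum_val (Ordinal (ltn_pmod j T0)).
exists ty => t.
have lt (i : 'I_k) : (i * #|T| + enum_rank t < n)%N.
  have : (i.+1 * #|T| <= n)%N by apply: leq_trans le; rewrite mulnC leq_mul2l ltn_ord orbT.
  by apply: leq_trans; rewrite mulSn addnC ltn_add2r.
pose h i := Ordinal (lt i).
have hI : injective h.
  by move=> i i' /(congr1 val)/= /addIn/eqP; rewrite eqn_pmul2r // => /eqP/val_inj.
rewrite -[k in (k <= _)%N]card_ord -(card_imset _ hI).
apply/subset_leq_card/fintype.subsetP => _ /imsetP[i _ ->]; rewrite finset.in_set.
apply/eqP; rewrite -[RHS]enum_rankK /ty; congr enum_val; apply: val_inj => /=.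
by rewrite modnMDl modn_small.
Qed.

(** The bound on [m] gives each type its own machine, for an optimum of at most 3; the bound on [n]
    leaves room for [m + 1] jobs of each type. *)
Lemma competitive_instance (R : realType) (A : algorithm R) (L m n : nat) :
  online_algorithm (@unweighted_types R) A ->
  (0 < L)%N -> (2 <= m)%N -> ((L * L) ^ L <= m)%N -> ((L * L) ^ L * m.+1 <= n)%N ->
  exists P, [/\ unweighted_types P, nmach P = m, njobs P = n &
    exists2 p : ptimes P, nonneg p & ((L%:R / 3)%:E <= makespan p (A P p) / opt p)%E].
Proof.
move=> onA L0 m2 Lm Ln.
pose T := {ffun 'I_L -> 'I_(L * L)}.
have cT : #|T| = ((L * L) ^ L)%N by rewrite card_ffun !card_ord.
have T0 : (0 < #|T|)%N by rewrite cT expn_gt0 muln_gt0 L0.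
have [ty fib] : exists ty : 'I_n -> T, forall t, (m.+1 <= #|[set j | ty j == t]%SET|)%N.
  by apply: large_fibres T0 _; rewrite cT.
have mn : (2 <= m <= n)%N.
  rewrite m2 /=; apply: leq_trans Ln; apply: leq_trans (leqnSn m) _.
  by apply: leq_pmull; rewrite -cT.
pose P := @Problem R n m (fun X => #|(ty @: X)%SET|%:R).
have UP : unweighted_types P by exact: unweighted_types_of.
have [Z [cZ mk]] := @makespan_lower R _ A P L ty onA UP (fun=> erefl) L0 fib.
exists P; split => //; exists (unit_times Z); first exact: unit_times_nonneg.
have := @opt_gt0 R P T ty (fun=> erefl) Z; have := @opt_le3 R P T ty (fun=> erefl) Z.
rewrite cT => /(_ Lm cZ) o3 /(_ (leq_trans (ltnW m2) (proj2 (andP mn)))); move: o3.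
case: (opt _) => [v||] //; rewrite lee_fin lte_fin => v3 v0.
rewrite inver gt_eqF // lee_pdivlMr //; apply: le_trans mk.
rewrite -EFinM lee_fin -[leRHS]mulr1 -mulrA ler_wpM2l // ler_pdivrMl //; lra.
Qed.

(** * Growth of [L] in terms of iterated logarithms *)

Lemma ln_div_lnln_le (R : realType) (k n : nat) : (0 < k)%N -> expR (expR 1) <= n%:R :> R ->
  exists L : nat, [/\ (0 < L)%N, (L ^ (k * L) <= n)%N &
    ln n%:R / ln (ln n%:R) <= 2 * k%:R * L%:R :> R].
Proof.
move=> k0 en; set x : R := ln n%:R; set y := ln x.
have n0 : 0 < n%:R :> R by apply: lt_le_trans en; exact: expR_gt0.
have xe : expR 1 <= x by rewrite -ler_expR lnK ?posrE.
have x0 : 0 < x by apply: lt_le_trans xe; exact: expR_gt0.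
have y1 : 1 <= y by rewrite -ler_expR lnK ?posrE.
pose Q L := (0 < L)%N && (L ^ (k * L) <= n)%N.
have Q1 : exists L, Q L by exists 1%N; rewrite /Q exp1n /= -(ltr_nat R).
have Qn L : Q L -> (L <= n)%N.
  move=> /andP[L0]; apply: leq_trans; rewrite -{1}[L]expn1 leq_pexp2l //.
  by rewrite muln_gt0 k0.
(* Maximality of [L] yields [ln n < k * (L + 1) * ln (L + 1)]. *)
case: (ex_maxnP Q1 Qn) => L /andP[L0 Ln] Lmax; exists L; split => //.
rewrite ler_pdivrMr ?(lt_le_trans _ y1) // leNgt; apply/negP => lt.
have L1 : 1 <= L%:R :> R by rewrite ler1n.
have k1 : 1 <= k%:R :> R by rewrite ler1n.
have : (n < L.+1 ^ (k * L.+1))%N.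
  by rewrite ltnNge; apply/negP => le; have := Lmax L.+1; rewrite /Q le ltnn => /(_ erefl).
rewrite -(ltr_nat R) natrX => n_lt.
have : x < (k * L.+1)%:R * ln L.+1%:R.
  by rewrite mulr_natl -lnXn ?ltr0n // ltr_ln ?posrE // exprn_gt0 ?ltr0n.
rewrite natrM -natr1 => x_lt.
have kL : L%:R <= k%:R * L%:R :> R by rewrite ler_peMl // ler0n.
have kLy : k%:R * L%:R <= k%:R * L%:R * y by rewrite ler_peMr // mulr_ge0 ?ler0n.
(* The negated goal gives [2 * L <= 2 * k * L * y < x], and [L + 1 <= 2 * L]. *)
have Lx : L%:R + 1 <= x by lra.
have lny : ln (L%:R + 1 : R) <= y by rewrite ler_ln // posrE; lra.
have : k%:R * (L%:R + 1) * ln (L%:R + 1) <= k%:R * (2 * L%:R) * y.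
  apply: ler_pM => //; first by apply: ln_ge0; lra.
  by rewrite ler_wpM2l ?ler0n //; lra.
by lra.
Qed.

(** * The bounds in [m] and in [n] *)

Theorem theorem11 (R : realType) :
  exists (C : R) (N : nat), 0 < C /\
    forall A : algorithm R, online_algorithm (@unweighted_types R) A ->
      (forall m : nat, (N <= m)%N ->
        ((C * (ln m%:R / ln (ln m%:R)))%:E <=
          competitive_ratio A
            (@unweighted_types R `&` [set P | nmach P = m]))%E) /\
      (forall n : nat, (N <= n)%N ->
        ((C * (ln n%:R / ln (ln n%:R)))%:E <=
          competitive_ratio A
            (@unweighted_types R `&` [set P | njobs P = n]))%E).
Proof.
have e3 : 3 <= expR (expR 1) :> R.
  by have := expR_ge1Dx (expR 1 : R); have := expR_ge1Dx (1 : R); lra.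
pose N := Num.bound (expR (expR 1) : R).
have eN n : (N <= n)%N -> expR (expR 1) <= n%:R :> R.
  by rewrite -(ler_nat R); apply/le_trans/ltW/archi_boundP/expR_ge0.
have sqE L : ((L * L) ^ L = L ^ (2 * L))%N by rewrite expnM.
(* The ratio is at least [L / 3], and [L] is at least the quotient of logarithms over [2 * k]; the
   larger [k], which is 6, gives [3 * 2 * 6 = 36]. *)
exists (36^-1), N; split; first by rewrite invr_gt0.
move=> A onA; split=> [m /eN em|n /eN en].
(* There are [L ^ (2 * L)] types, hence [k = 2]. *)
- have [L [L0 Lm ratio]] := @ln_div_lnln_le R 2 m isT em.
  have m3 : (3 <= m)%N by rewrite -(ler_nat R); exact: le_trans em.
  have [|P [UP Pm _ [p p0 le]]] := @competitive_instance R A L m _ onA L0 (ltnW m3) _ (leqnn _).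
    by rewrite sqE.
  apply: le_trans (ereal_sup_ubound _); last by exists P; split => //; exists p.
  apply: le_trans le; rewrite lee_fin; move: ratio; set r := (_ / ln _).
  by have := ler0n R L; lra.
(* With [k = 6], [n] is at least the cube of the number [t] of types, which leaves room for [t + 1]
   machines and [t + 2] jobs per type. *)
- have [L [L0 Ln ratio]] := @ln_div_lnln_le R 6 n isT en.
  have n3 : (3 <= n)%N by rewrite -(ler_nat R); exact: le_trans en.
  pose t := ((L * L) ^ L)%N.
  have t0 : (0 < t)%N by rewrite expn_gt0 muln_gt0 L0.
  have t3 : (t * t * t <= n)%N.
    by apply: leq_trans Ln; rewrite /t sqE -!expnD -!mulnDl.
  (* The cube suffices for [t >= 2]; for [t = 1] the bound [3 <= n] is used. *)
  have tn : (t * t.+2 <= n)%N.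
    move: t0 t3; case: (t) => [//|[|u]] _ ?; first lia.
    suff : (u.+2 * u.+4 <= u.+2 * u.+2 * u.+2)%N by lia.
    by rewrite -mulnA leq_mul2l; lia.
  have [P [UP _ Pn [p p0 le]]] :=
    @competitive_instance R A L t.+1 n onA L0 t0 (leqnSn t) tn.
  apply: le_trans (ereal_sup_ubound _); last by exists P; split => //; exists p.
  apply: le_trans le; rewrite lee_fin; move: ratio; set r := (_ / ln _).
  by have := ler0n R L; lra.
Qed.
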